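(* For every $t>0$ and every fixed 2-dimensional linear subspace $L$, $$\mathbb{E}_V\bigl[\overline{\mathrm{cr}}(G_L)\,\mathrm{stress}(G,G_L)\bigr]\ge\mathbb{E}_V\,\overline{\mathrm{cr}}(G_L)\;\mathbb{E}_V\,\mathrm{stress}(G,G_L),$$ i.e. $\mathrm{Cov}_V(\overline{\mathrm{cr}}(G_L),\mathrm{stress}(G,G_L))\ge0$.
   Context: Let $W\subset\mathbb{R}^d$ ($d\ge2$) be a compact convex set with $\mathrm{vol}_d(W)=1$; for $t>0$, $V$ is a Poisson point process of intensity $t$ on $W$ (draw $N\sim\mathrm{Poisson}(t)$, then $N$ i.i.d. uniform points in $W$); $\delta_t>0$. The graph $G$ has vertex set $V$ and a straight-segment edge between distinct $u,v\in V$ iff $\|u-v\|\le\delta_t$. For a 2-dimensional linear subspace $L$, $x|_L$ denotes orthogonal projection onto $L$, $[u,v]$ the segment from $u$ to $v$, and $V^k_{\neq}$ ordered $k$-tuples of pairwise distinct points of $V$. Define $$\overline{\mathrm{cr}}(G_L)=\tfrac18\sum_{(v_1,\dots,v_4)\in V^4_{\neq}}\mathbf 1\bigl([v_1,v_2]|_L\cap[v_3,v_4]|_L\neq\emptyset\bigr)\mathbf 1(\|v_1-v_2\|\le\delta_t)\mathbf 1(\|v_3-v_4\|\le\delta_t),$$ $$\mathrm{stress}(G,G_L)=\tfrac12\sum_{(v_1,v_2)\in V^2_{\neq}}w(v_1,v_2)\bigl(d_0(v_1,v_2)-d_L(v_1,v_2)\bigr)^2,$$ with $w:W\times W\to(0,\infty)$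 measurable, $d_0(v_1,v_2)=\|v_1-v_2\|$, $d_L(v_1,v_2)=\|v_1|_L-v_2|_L\|$. Assume $\mathrm{stress}(G,G_L)$ has finite second moment. *)

(* Defs.v *)
From HB Require Import structures.
From mathcomp Require Import all_boot all_order all_algebra.
From mathcomp Require Import all_classical all_reals all_analysis.
Set Implicit Arguments. Unset Strict Implicit. Unset Printing Implicit Defensive.
Import Order.TTheory GRing.Theory Num.Theory.
Local Open Scope classical_set_scope.
Local Open Scope ring_scope.

Section Defs.
Context {R : realType} {d : nat}.
Notation vec := 'rV[R]_d.

Definition dotv (u v : vec) : R := \sum_(j < d) u 0 j * v 0 j.
Definition enorm (u : vec) : R := Num.sqrt (dotv u u).

Definition box (a b : vec) : set vec :=
  [set x | forall j : 'I_d, a 0 j <= x 0 j < b 0 j].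
Definition boxvol (a b : vec) : R := \prod_(j < d) Num.max (b 0 j - a 0 j) 0.

Definition vol_d (A : set vec) : \bar R :=
  ereal_inf [set s | exists a b : nat -> vec,
      A `<=` \bigcup_k box (a k) (b k) /\
      s = (\sum_(0 <= k <oo) (boxvol (a k) (b k))%:E)%E].

Definition borel_d : set (set vec) := <<s [set box a b | a in setT & b in setT] >>.
Definition borel_dd : set (set (vec * vec)) :=
  <<s [set A `*` B | A in borel_d & B in borel_d] >>.

Definition is_convex_set (W : set vec) : Prop :=
  forall x y s, W x -> W y -> 0 <= s <= 1 -> W ((1 - s) *: x + s *: y).

(* Linear subspaces are represented as row spaces of square matrices
   (mxalgebra convention); orthogonal projection onto the row space of L. *)
Definition oproj (L : 'M[R]_d) (x : vec) : vec :=
  xget 0 [set p : vec | (p <= L)%MS /\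
                        forall v : vec, (v <= L)%MS -> dotv (x - p) v = 0].

Definition segment (a b : vec) : set vec :=
  [set (1 - s) *: a + s *: b | s in [set s : R | 0 <= s <= 1]].

Definition proj_cross (L : 'M[R]_d) (v1 v2 v3 v4 : vec) : Prop :=
  (oproj L @` segment v1 v2) `&` (oproj L @` segment v3 v4) !=set0.

Definition indR (P : Prop) : R := if `[< P >] then 1 else 0.

Definition vertex_seq (N : nat) (X : nat -> vec) : seq vec :=
  undup [seq X i | i <- iota 0 N].

Definition cr_bar (L : 'M[R]_d) (delta : R) (V : seq vec) : R :=
  8^-1 * \sum_(v1 <- V) \sum_(v2 <- V) \sum_(v3 <- V) \sum_(v4 <- V)
    (if [&& v1 != v2, v1 != v3, v1 != v4, v2 != v3, v2 != v4 & v3 != v4]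
     then indR (proj_cross L v1 v2 v3 v4)
          * indR (enorm (v1 - v2) <= delta) * indR (enorm (v3 - v4) <= delta)
     else 0).

Definition stress (L : 'M[R]_d) (w : vec -> vec -> R) (V : seq vec) : R :=
  2^-1 * \sum_(v1 <- V) \sum_(v2 <- V)
    (if v1 != v2
     then w v1 v2 * (enorm (v1 - v2) - enorm (oproj L v1 - oproj L v2)) ^+ 2
     else 0).

End Defs.

(* V is a Poisson point process of intensity t on W, realised on a probability
   space: N ~ Poisson(t), X_0, X_1, ... uniform on W (vol W = 1), and
   N, X_0, X_1, ... mutually independent. *)
Definition poisson_pp {R : realType} {d : nat} (dO : measure_display)
  (O : measurableType dO) (P : probability O R) (t : R)
  (W : set 'rV[R]_d) (N : O -> nat) (X : nat -> O -> 'rV[R]_d) : Prop :=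
  [/\ forall k : nat, measurable [set w | N w = k],
      forall (i : nat) (A : set 'rV[R]_d), borel_d A -> measurable (X i @^-1` A),
      forall k : nat, P [set w | N w = k] = (poisson_pmf t k)%:E,
      forall (i : nat) (A : set 'rV[R]_d), borel_d A ->
        P (X i @^-1` A) = vol_d (A `&` W) &
      forall (n : nat) (B : set nat) (A : nat -> set 'rV[R]_d),
        (forall i, borel_d (A i)) ->
        P ([set w | B (N w)] `&` \bigcap_(i in [set i | (i < n)%N]) (X i @^-1` A i))
        = (P [set w | B (N w)] * \prod_(i < n) P (X i @^-1` A i))%E].

(* Main.v *)
Require Import Defs.
From HB Require Import structures.
From mathcomp Require Import all_boot all_order all_algebra.
From mathcomp Require Import all_classical all_reals all_analysis.
From mathcomp Require Import measurable_realfun.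
From mathcomp Require Import ring lra.
Import Order.TTheory GRing.Theory Num.Theory.
Import numFieldNormedType.Exports.
Local Open Scope classical_set_scope.
Local Open Scope ring_scope.
Set Implicit Arguments.
Unset Strict Implicit.

(** Both statistics are U-statistics of the Poisson process with nonnegative
    kernels: [cr] is a sum over 4-tuples and [stress] a sum over pairs of
    distinct points. Expand the product [cr * stress] into a sum over (4-tuple,
    pair) and drop the nonnegative terms in which the pair meets the 4-tuple.
    What remains is a sum over 6-tuples of distinct points of the product
    kernel. The k-th factorial moment of a Poisson(t) variable is [t ^ k], and
    the points are independent, so its expectation is
    [t^6 E[f] E[g] = (t^4 E[f]) (t^2 E[g])], the product of the two
    expectations. *)

(** * Integration and independence *)

(** Independence is used through measures: on the event [N = n], the joint law of finitely many
    distinct [X i] is the mass of the event times a product measure, built up one point at a time.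
    The product of the two expectations is then exactly the expectation of the six-index sum, so
    that, when all is finite, the covariance equals the expected contribution of the overlapping
    terms.

    The obstacle is that the graph statistics range over distinct points ([vertex_seq] removes
    repetitions), whereas the moment computation needs measurable kernels summed over distinct
    indices. The two agree where all [X i] lie in [W] and no two of them coincide. This event has
    full probability: a tie forces two points into a common thin slab of [W]. The transfer relies on
    integrals that do not see null sets, even for integrands not known to be measurable. All
    expectations are taken in [[0, +oo]]. *)

Section integration.
Local Open Scope ereal_scope.
Context d (T : measurableType d) (R : realType) (mu : {measure set T -> \bar R}).

Import HBNNSimple.

(** A simple function below [f], cut down to [D], lies below [g] everywhere (off [D] it is 0) and
    keeps its integral, since only a null set is lost. *)
Lemma ge0_le_integral_full (D : set T) (f g : T -> \bar R) :
  measurable D -> mu (~` D) = 0 ->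
  (forall x, 0 <= f x) -> (forall x, 0 <= g x) ->
  (forall x, D x -> f x <= g x) ->
  \int[mu]_x f x <= \int[mu]_x g x.
Proof.
move=> mD D0 f0 g0 fg; rewrite ge0_integralTE// ge0_integralTE//.
apply: ge_ereal_sup => _ [h /= hf <-].
have hE x : proj_nnsfun h mD x = (h \_ D) x by rewrite (mrestrict h mD).
apply: ereal_sup_ubound; exists (proj_nnsfun h mD).
  move=> x; rewrite hE patchE; case: ifPn => // /[!inE] Dx.
  exact: le_trans (hf x) (fg _ Dx).
rewrite -[LHS](integralT_nnsfun mu (proj_nnsfun h mD)) -(integralT_nnsfun mu h).
apply: ge0_ae_eq_integral => //.
- exact: measurableT_comp.
- exact: measurableT_comp.
- by move=> x _; rewrite lee_fin.
- by move=> x _; rewrite lee_fin.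
exists (~` D); split => //; first exact: measurableC.
move=> x /= nx Dx; apply: nx => _.
by congr EFin; have := hE x; rewrite patchE mem_set.
Qed.

(* No measurability of [f] or [g] is required: the integral of a nonnegative
   function is defined as a supremum over simple functions below it. *)
Lemma eq_integral_full (D : set T) (f g : T -> \bar R) :
  measurable D -> mu (~` D) = 0 -> (forall x, D x -> f x = g x) ->
  \int[mu]_x f x = \int[mu]_x g x.
Proof.
move=> mD D0 fg; rewrite integralE [RHS]integralE; congr (_ - _).
- by apply/eqP; rewrite eq_le; apply/andP; split;
    apply: (ge0_le_integral_full mD D0) => // x Dx;
    rewrite !funeposE fg.
- by apply/eqP; rewrite eq_le; apply/andP; split;
    apply: (ge0_le_integral_full mD D0) => // x Dx;
    rewrite !funenegE fg.
Qed.

Lemma ge0_integral_mrestr (D : set T) (mD : measurable D) (f : T -> \bar R) :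
  measurable_fun setT f -> (forall x, 0 <= f x) ->
  \int[mrestr mu mD]_x f x = \int[mu]_(x in D) f x.
Proof.
move=> mf f0.
rewrite [LHS](@ge0_negligible_integral _ _ _ (mrestr mu mD) setT (~` D))//; last 2 first.
- exact: measurableC.
- by rewrite /= /mrestr setICl measure0.
rewrite setTD setCK; apply: eq_measure_integral => A mA AD.
by rewrite /= /mrestr setIidl.
Qed.

End integration.

(** Measurable rectangles are stable under intersection and generate the product sigma-algebra, so
    they determine a finite measure. The factor [p] serves laws restricted to an event, whose total
    mass may be below 1. *)
Lemma measure_unique_prod d1 d2 (T1 : measurableType d1)
    (T2 : measurableType d2) (R : realType) (P1 : probability T1 R)
    (P2 : probability T2 R) (p : {nonneg R})
    (m : {measure set (T1 * T2) -> \bar R}) :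
  (forall A B, measurable A -> measurable B ->
    m (A `*` B) = (p%:num%:E * (P1 A * P2 B))%E) ->
  forall E, measurable E -> m E = (p%:num%:E * (P1 \x P2)%E E)%E.
Proof.
move=> mE.
apply: (@measure_unique _ _ _ [set A `*` B | A in measurable & B in measurable]
  (fun=> setT) _ _ _ _ m (mscale p (P1 \x P2)%E)).
- exact: measurable_prod_measurableType.
- move=> _ _ [A mA [B mB <-]] [A' mA' [B' mB' <-]]; rewrite -setXI.
  by exists (A `&` A'); [exact: measurableI | exists (B `&` B');
    [exact: measurableI|]].
- by move=> _; exists setT => //; exists setT => //; rewrite setXTT.
- by rewrite bigcup_const.
- by move=> _ [A mA [B mB <-]]; rewrite mE// -product_measure1E.
- move=> _; rewrite -setXTT mE//.
  by rewrite !probability_setT !mule1 ltry.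
Qed.

Section independence.
Local Open Scope ereal_scope.
Context (R : realType) dO (O : measurableType dO) (P : probability O R)
  dT (T : measurableType dT) (F : set O) (X : nat -> O -> T)
  (mu : probability T R).
Hypothesis mF : measurable F.
Hypothesis mX : forall i, measurable_fun setT (X i).
Hypothesis indX : forall (l : seq nat) (A : nat -> set T), uniq l ->
  (forall i, measurable (A i)) ->
  P (F `&` \big[setI/setT]_(i <- l) (X i @^-1` A i))
  = P F * \prod_(i <- l) mu (A i).

(* [Y] has law [nu], is independent of [F] and of the [X i] with
   [i \notin s]. *)
Definition indep_block (s : seq nat) {d} {S : measurableType d} (Y : O -> S)
    (nu : probability S R) : Prop :=
  forall (l : seq nat) (A : nat -> set T), uniq l ->
    (forall i, i \in l -> i \notin s) ->
    (forall i, measurable (A i)) -> forall E, measurable E ->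
  P (F `&` \big[setI/setT]_(i <- l) (X i @^-1` A i) `&` Y @^-1` E)
  = P F * \prod_(i <- l) mu (A i) * nu E.

Let mXA i A : measurable A -> measurable (X i @^-1` A).
Proof. by move=> mA; rewrite -[_ @^-1` _]setTI; exact: mX. Qed.

Lemma indep_block1 j : indep_block [:: j] (X j) mu.
Proof.
move=> l A ul lj mA E mE.
pose A' i := if i == j then E else A i.
have jl : j \notin l by apply/negP => /lj; rewrite inE eqxx.
have mA' i : measurable (A' i) by rewrite /A'; case: ifP.
have := @indX (j :: l) A'; rewrite /= jl ul => /(_ erefl mA').
rewrite !big_cons /A' eqxx.
have e i : i \in l -> (i == j) = false.
  by move=> il; apply: contraNF jl => /eqP <-.
rewrite (@eq_big_seq _ _ _ _ _ _ (fun i => X i @^-1` A i)) => [|i /e->//].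
rewrite (@eq_big_seq _ _ _ _ _ _ (fun i => mu (A i))) => [|i /e->//].
by rewrite setICA setIC => ->; rewrite -muleA [mu E * _]muleC.
Qed.

(** The quantification over [l] in [indep_block] carries the induction: for a product event, the
    condition on [X j] joins the list [l], where the hypothesis on [Y] handles it. Uniqueness of
    measures extends the identity from rectangles to all events. *)
Lemma indep_blockS s j d (S : measurableType d) (Y : O -> S)
    (nu : probability S R) : measurable_fun setT Y -> j \notin s ->
  indep_block s Y nu ->
  indep_block (j :: s) (fun w => (Y w, X j w)) (nu \x mu).
Proof.
move=> mY js indY l A ul lj mA E mE.
have jl : j \notin l by apply/negP => /lj; rewrite inE eqxx.
set G := F `&` \big[setI/setT]_(i <- l) (X i @^-1` A i).
have mG : measurable G.
  apply: measurableI => //.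
  elim/big_ind : _ => //; [exact: measurableI|by move=> i _; exact: mXA].
have q0 : 0 <= P F * \prod_(i <- l) mu (A i).
  by apply: mule_ge0 => //; apply: prode_ge0.
have qfin : P F * \prod_(i <- l) mu (A i) \is a fin_num.
  rewrite fin_numM ?fin_num_measure//.
  by elim/big_ind : _ => // [x y|i _]; [exact: fin_numM|exact: fin_num_measure].
have [q qE] : exists q : {nonneg R}, P F * \prod_(i <- l) mu (A i) = q%:num%:E.
  move: q0; rewrite -(fineK qfin) lee_fin => q0.
  by exists (NngNum q0).
have mYX : measurable_fun setT (fun w => (Y w, X j w)).
  exact: measurable_fun_pair.
rewrite qE.
have := @measure_unique_prod _ _ _ _ _ nu mu q
  (pushforward (mrestr P mG) (fun w => (Y w, X j w))).
rewrite /= /pushforward /mrestr => <- //; first by rewrite setIC.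
move=> B C mB mC.
pose A' i := if i == j then C else A i.
have mA' i : measurable (A' i) by rewrite /A'; case: ifP.
have := @indY (j :: l) A'; rewrite /= jl ul => /(_ erefl).
have H i : i \in j :: l -> i \notin s.
  by rewrite inE => /orP[/eqP ->//|/lj]; rewrite inE negb_or => /andP[].
move=> /(_ H mA' B mB).
rewrite !big_cons /A' eqxx.
have e i : i \in l -> (i == j) = false.
  by move=> il; apply: contraNF jl => /eqP <-.
rewrite (@eq_big_seq _ _ _ _ _ _ (fun i => X i @^-1` A i)) => [|i /e->//].
rewrite (@eq_big_seq _ _ _ _ _ _ (fun i => mu (A i))) => [|i /e->//].
move=> eq1; transitivity (P (F `&` (X j @^-1` C `&`
    \big[setI/[set: O]]_(i <- l) X i @^-1` A i) `&` Y @^-1` B)).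
  congr (P _); rewrite /G; apply/seteqP; split => x /=.
    by move=> [[? ?] [? ?]].
  by move=> [[? [? ?]] ?].
by rewrite eq1 -qE [mu C * _]muleC -!muleA [mu C * _]muleC.
Qed.

(** With [l] empty, [indep_block] says that the image under [Y] of [P] restricted to [F] is [P F]
    times [nu]; the rest is a change of variables. *)
Lemma indep_block_integral s d (S : measurableType d) (Y : O -> S)
    (nu : probability S R) (h : S -> \bar R) :
  measurable_fun setT Y -> indep_block s Y nu ->
  measurable_fun setT h -> (forall x, 0 <= h x) ->
  \int[P]_(w in F) h (Y w) = P F * \int[nu]_x h x.
Proof.
move=> mY indY mh h0.
rewrite -(ge0_integral_mrestr P mF)//; last exact: measurableT_comp.
have := @ge0_integral_pushforward _ _ _ _ _ _ mY (mrestr P mF) setT h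
  measurableT mh.
rewrite preimage_setT => <-; last by move=> ? _; exact: h0.
have [p pE] : exists p : {nonneg R}, P F = p%:num%:E.
  have p0 : (0 <= fine (P F))%R by rewrite fine_ge0.
  by exists (NngNum p0); rewrite /= fineK// fin_num_measure.
rewrite pE -(ge0_integral_mscale nu measurableT)//.
apply: eq_measure_integral => A mA _.
have := @indY [::] (fun=> setT) erefl; rewrite !big_nil => indA.
rewrite /= /pushforward /mrestr /mscale -pE setIC.
by rewrite -{1}(setIT F) indA// mule1.
Qed.

End independence.

(** * Factorial moments *)

(** The first [k] terms vanish. Beyond them [n ^_ k / n!] is [1 / (n - k)!], so a shift by [k]
    extracts [t ^+ k] and leaves the total mass of the Poisson law. *)
Lemma nneseries_ffact_poisson (R : realType) (t : R) (k : nat) : 0 < t ->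
  (\sum_(n <oo) ((n ^_ k)%:R * poisson_pmf t n)%:E = (t ^+ k)%:E)%E.
Proof.
move=> t0.
have pmfE n : poisson_pmf t n = t ^+ n * n`!%:R^-1 * expR (- t).
  by rewrite /poisson_pmf t0.
have f0 n : (0 <= ((n ^_ k)%:R * poisson_pmf t n)%:E)%E.
  by rewrite lee_fin mulr_ge0// poisson_pmf_ge0.
rewrite (nneseries_split 0 k)// big1_seq ?add0e => [|n]; last first.
  by rewrite mem_index_iota add0n => /= nk; rewrite ffact_small// mul0r.
rewrite add0n -nneseries_addn//.
transitivity (\sum_(n <oo) ((t ^+ k)%:E * (poisson_pmf t n)%:E))%E.
  apply: eq_eseriesr => n _; rewrite -EFinM; congr EFin.
  rewrite !pmfE exprD.
  have -> : (n + k)`!%:R = ((n + k) ^_ k)%:R * n`!%:R :> R.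
    by rewrite -natrM -(ffact_fact (leq_addl n k)) addnK.
  have : ((n + k) ^_ k)%:R != 0 :> R.
    by rewrite pnatr_eq0 -lt0n ffact_gt0 leq_addl.
  have : n`!%:R != 0 :> R by rewrite pnatr_eq0 -lt0n fact_gt0.
  by move=> ? ?; field; apply/andP.
rewrite nneseriesZl; last by move=> n _; rewrite lee_fin poisson_pmf_ge0.
suff -> : (\sum_(n <oo) (poisson_pmf t n)%:E = 1)%E by rewrite mule1.
rewrite nneseries_esumT => [|n]; last by rewrite lee_fin poisson_pmf_ge0.
by rewrite -(probability_setT (poisson_prob t 0)) /= /poisson_prob t0.
Qed.

(* The number of ways to prepend [k] indices to [l] with a duplicate-free
   result. *)
Fixpoint uniq_ext (n k : nat) (l : seq 'I_n) : nat :=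
  if k is k'.+1 then (\sum_(j < n) uniq_ext k' (j :: l))%N else uniq l.

(** A duplicate-free [l] can be prolonged by [n - size l] indices, any other [l] by none; iterating
    gives the falling factorial. *)
Lemma uniq_extE n k (l : seq 'I_n) :
  uniq_ext k l = (uniq l * (n - size l) ^_ k)%N.
Proof.
elim: k l => [|k IH] l /=; first by rewrite ffactn0 muln1.
under eq_bigr do rewrite IH /= subnS.
rewrite -big_distrl/= ffactnS mulnA; congr (_ * _)%N.
have [/card_uniqP ul|_] := boolP (uniq l); last first.
  by rewrite big1// => j _; rewrite andbF.
rewrite mul1n -ul -[X in (X - _)%N]card_ord -(cardC (mem l)) addKn.
rewrite -sum1_card [RHS]big_mkcond; apply: eq_bigr => j _.
by rewrite !inE andbT; case: (j \in l).
Qed.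

(** Coordinates are listed from last to first, the order in which [uniq_ext] and [indep_blockS]
    prepend indices. *)
Definition distinct2 n (r : 'I_n * 'I_n) := uniq [:: r.2; r.1].
Definition distinct4 n (q : 'I_n * 'I_n * 'I_n * 'I_n) :=
  uniq [:: q.2; q.1.2; q.1.1.2; q.1.1.1].
Definition distinct6 n (p : ('I_n * 'I_n * 'I_n * 'I_n) * ('I_n * 'I_n)) :=
  uniq [:: p.2.2; p.2.1; p.1.2; p.1.1.2; p.1.1.1.2; p.1.1.1.1].

Lemma card_distinct2 n : #|@distinct2 n| = (n ^_ 2)%N.
Proof.
have := uniq_extE 2 ([::] : seq 'I_n); rewrite /= subn0 mul1n => <-.
by rewrite -sum1_card big_mkcond pair_bigA; apply: eq_bigr => -[? ?] _.
Qed.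

Lemma card_distinct4 n : #|@distinct4 n| = (n ^_ 4)%N.
Proof.
have := uniq_extE 4 ([::] : seq 'I_n); rewrite /= subn0 mul1n => <-.
by rewrite -sum1_card big_mkcond !pair_bigA; apply: eq_bigr => -[[[? ?] ?] ?] _.
Qed.

Lemma card_distinct6 n : #|@distinct6 n| = (n ^_ 6)%N.
Proof.
have := uniq_extE 6 ([::] : seq 'I_n); rewrite /= subn0 mul1n => <-.
rewrite -sum1_card big_mkcond !pair_bigA/=.
rewrite (reindex (fun p : ('I_n * 'I_n * 'I_n * 'I_n * 'I_n * 'I_n) =>
  (p.1.1, (p.1.2, p.2))))/=.
  by apply: eq_bigr => -[[[[[? ?] ?] ?] ?] ?] _.
exists (fun p => ((p.1, p.2.1), p.2.2)); by [move=> [[? ?] ?]|move=> [? [? ?]]].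
Qed.

Section poisson_statistics.
Local Open Scope ereal_scope.
Context (R : realType) dO (O : measurableType dO) (P : probability O R)
  (N : O -> nat) (t : R).
Hypothesis t0 : (0 < t)%R.
Hypothesis mN : forall n, measurable [set w | N w = n].
Hypothesis PN : forall n, P [set w | N w = n] = (poisson_pmf t n)%:E.

Let trivN : trivIset setT (fun n => [set w | N w = n]).
Proof. by move=> i j _ _ [w [/= <- <-]]. Qed.

Let bigcupN : \bigcup_n [set w | N w = n] = setT.
Proof. by apply/seteqP; split => // w _; exists (N w). Qed.

Lemma measurable_fun_poisson_mixture (g : nat -> O -> \bar R) :
  (forall n, measurable_fun setT (g n)) ->
  measurable_fun setT (fun w => g (N w) w).
Proof.
move=> mg; rewrite -bigcupN; apply/measurable_fun_bigcup => // n.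
apply: (eq_measurable_fun (g n)); last exact: measurable_funTS.
by move=> w /[!inE] /= ->.
Qed.

(** Splitting over the values of [N] leaves the series of [n ^_ k] times the Poisson weights, a
    factorial moment. An infinite [e] is allowed and treated apart. *)
Lemma integral_poisson_sum (K : nat -> finType) (Q : forall n, pred (K n))
    (h : forall n, K n -> O -> R) (k : nat) (e : \bar R) :
  (forall n, #|Q n| = (n ^_ k)%N) -> 0 <= e ->
  (forall n i, measurable_fun setT (h n i)) ->
  (forall n i w, (0 <= h n i w)%R) ->
  (forall n i, Q n i ->
    \int[P]_(w in [set w | N w = n]) (h n i w)%:E = P [set w | N w = n] * e) ->
  \int[P]_w (\sum_(i | Q (N w) i) h (N w) i w)%:E = (t ^+ k)%:E * e.
Proof.
move=> cardQ e0 mh h0 he.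
pose g n w := \sum_(i | Q n i) (h n i w)%:E.
have g0 n w : 0 <= g n w by apply: sume_ge0 => i _; rewrite lee_fin.
have mg n : measurable_fun setT (g n).
  rewrite /g; under eq_fun do rewrite -big_filter.
  by apply: emeasurable_sum => i; exact/measurable_EFinP.
transitivity (\int[P]_w g (N w) w).
  by apply: eq_integral => w _; rewrite /g sumEFin.
rewrite -bigcupN ge0_integral_bigcup//=; last first.
  by rewrite bigcupN; exact: measurable_fun_poisson_mixture.
rewrite -nneseries_ffact_poisson//.
transitivity (\sum_(n <oo) (((n ^_ k)%:R * poisson_pmf t n)%:E * e)); last first.
  rewrite [RHS]muleC.
  case: e e0 {he} => [r| |]//= r0.
    rewrite -nneseriesZl//; last first.
      by move=> n _; rewrite lee_fin mulr_ge0// poisson_pmf_ge0.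
    by under eq_eseriesr do rewrite muleC.
  rewrite nneseries_ffact_poisson// gt0_mulye ?lte_fin ?exprn_gt0//.
  have a0 n : 0 <= ((n ^_ k)%:R * poisson_pmf t n)%:E.
    by rewrite lee_fin mulr_ge0// poisson_pmf_ge0.
  apply/eqP; rewrite -leye_eq.
  (* Here [e] is infinite. The partial sum of the terms [n <= k] is already infinite, because the
     coefficient at [n = k] is [k!] times a positive weight. *)
  apply: le_trans (nneseries_lim_ge k.+1 _); last first.
    by move=> n _ _; rewrite mule_ge0.
  rewrite big_nat_recr//= gt0_muley; last first.
    rewrite lte_fin mulr_gt0// ?ltr0n ?ffact_gt0// /poisson_pmf t0.
    by rewrite !mulr_gt0// ?expR_gt0 ?exprn_gt0// invr_gt0 ltr0n fact_gt0.
  by rewrite leeDr// sume_ge0// => n _; rewrite mule_ge0.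
apply: eq_eseriesr => n _.
transitivity (\int[P]_(w in [set w | N w = n]) g n w).
  by apply: eq_integral => w /[!inE] /= ->.
rewrite /g; under eq_integral do rewrite -big_filter.
rewrite ge0_integral_sum//; last 2 first.
- by move=> i; apply/measurable_EFinP; exact: measurable_funTS.
- by move=> i w _; rewrite lee_fin.
rewrite big_filter (eq_bigr (fun=> P [set w | N w = n] * e)) => [|i Qi]; last first.
  exact: he.
by rewrite sumr_const cardQ EFinM -muleA mule_natl PN.
Qed.

End poisson_statistics.

(** * Covariance of nonnegative U-statistics *)

(** Products of measures associate to the left, so [mu \x mu] is not a literal factor on the
    left-hand side. Tonelli is therefore applied one coordinate at a time, with [S2] the integral of
    [g] over its second argument. *)
Lemma integral_prod_mul2 (R : realType) dS (S : measurableType dS)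
    dT (T : measurableType dT) (nu : probability S R) (mu : probability T R)
    (f : S -> R) (g : T * T -> R) :
  measurable_fun setT f -> measurable_fun setT g ->
  (forall x, 0 <= f x) -> (forall x, 0 <= g x) ->
  (\int[nu \x mu \x mu]_x (f x.1.1 * g (x.1.2, x.2))%:E
  = \int[nu]_x (f x)%:E * \int[mu \x mu]_x (g x)%:E)%E.
Proof.
move=> mf mg f0 g0.
have mfE : measurable_fun setT (EFin \o f) by exact/measurable_EFinP.
have mgE : measurable_fun setT (EFin \o g) by exact/measurable_EFinP.
have g0E x : (0 <= (EFin \o g) x)%E by rewrite /= lee_fin.
pose S2 := fubini_F mu (EFin \o g).
have S0 b : (0 <= S2 b)%E by apply: integral_ge0.
have mS : measurable_fun setT S2 by exact: measurable_fun_fubini_tonelli_F.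
have e20 : (0 <= \int[mu \x mu]_x (g x)%:E)%E.
  by apply: integral_ge0 => x _; exact: g0E.
pose H (x : S * T * T) := (f x.1.1 * g (x.1.2, x.2))%:E.
have mH : measurable_fun setT H.
  apply/measurable_EFinP/measurable_funM.
    by apply: measurableT_comp => //; exact: measurableT_comp.
  apply: measurableT_comp => //; apply: measurable_fun_pair => //.
  exact: measurableT_comp.
have H0 x : (0 <= H x)%E by rewrite lee_fin mulr_ge0.
pose G (x : S * T) := ((f x.1)%:E * S2 x.2)%E.
have mG : measurable_fun setT G.
  apply: emeasurable_funM; first exact: (measurableT_comp mfE).
  exact: (measurableT_comp mS).
have G0 x : (0 <= G x)%E by rewrite mule_ge0// lee_fin.
transitivity (\int[nu \x mu]_x fubini_F mu H x)%E.
  pose num : probability (S * T)%type R := (nu \x mu)%E.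
  exact: (@fubini_tonelli1 _ _ _ _ R num mu H mH H0).
transitivity (\int[nu \x mu]_x G x)%E.
  apply: eq_integral => -[a b] _; rewrite /fubini_F /H /G /=.
  under eq_integral do rewrite EFinM.
  rewrite ge0_integralZl//.
  - exact: (measurable_fun_pair2 b mgE).
  - by move=> y _; exact: g0E.
  - by rewrite lee_fin.
transitivity (\int[nu]_x fubini_F mu G x)%E.
  exact: (@fubini_tonelli1 _ _ _ _ R nu mu G mG G0).
rewrite -ge0_integralZr//; last by move=> x _; rewrite lee_fin.
apply: eq_integral => a _; rewrite /fubini_F /G/= ge0_integralZl// ?lee_fin//.
by congr (_ * _)%E; apply/esym;
  exact: (@fubini_tonelli1 _ _ _ _ R mu mu (EFin \o g) mgE g0E).
Qed.

Definition ustat4 {R : realType} {U : Type} (f : U * U * U * U -> R)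
    (x : nat -> U) n :=
  \sum_(q : 'I_n * 'I_n * 'I_n * 'I_n | distinct4 q)
    f (x q.1.1.1, x q.1.1.2, x q.1.2, x q.2).

Definition ustat2 {R : realType} {U : Type} (g : U * U -> R)
    (x : nat -> U) n :=
  \sum_(r : 'I_n * 'I_n | distinct2 r) g (x r.1, x r.2).

Section poisson_covariance.
Local Open Scope ereal_scope.
Context (R : realType) dO (O : measurableType dO) (P : probability O R)
  dT (T : measurableType dT) (mu : probability T R)
  (N : O -> nat) (X : nat -> O -> T) (t : R).
Hypothesis t0 : (0 < t)%R.
Hypothesis mN : forall n, measurable [set w | N w = n].
Hypothesis PN : forall n, P [set w | N w = n] = (poisson_pmf t n)%:E.
Hypothesis mX : forall i, measurable_fun setT (X i).
Hypothesis indNX : forall n (l : seq nat) (A : nat -> set T), uniq l ->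
  (forall i, measurable (A i)) ->
  P ([set w | N w = n] `&` \big[setI/setT]_(i <- l) (X i @^-1` A i))
  = P [set w | N w = n] * \prod_(i <- l) mu (A i).
Variables (f : T * T * T * T -> R) (g : T * T -> R).
Hypothesis mf : measurable_fun setT f.
Hypothesis mg : measurable_fun setT g.
Hypothesis f0 : forall x, (0 <= f x)%R.
Hypothesis g0 : forall x, (0 <= g x)%R.

Let e4 := \int[mu \x mu \x mu \x mu]_x (f x)%:E.
Let e2 := \int[mu \x mu]_x (g x)%:E.

Let block2 n i1 i2 : uniq [:: i2; i1] ->
  indep_block P [set w | N w = n] X mu [:: i2; i1]
    (fun w => (X i1 w, X i2 w)) (mu \x mu)%E.
Proof.
rewrite cons_uniq => /andP[n2 _].
apply: indep_blockS => //; apply: indep_block1 => //; exact: indNX.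
Qed.

Let block4 n i1 i2 i3 i4 : uniq [:: i4; i3; i2; i1] ->
  indep_block P [set w | N w = n] X mu [:: i4; i3; i2; i1]
    (fun w => (X i1 w, X i2 w, X i3 w, X i4 w)) (mu \x mu \x mu \x mu)%E.
Proof.
rewrite cons_uniq => /andP[n4]; rewrite cons_uniq => /andP[n3 n2].
apply: indep_blockS => //.
  by do 2 apply: measurable_fun_pair => //.
apply: indep_blockS => //; first exact: measurable_fun_pair.
exact: block2.
Qed.

Let block6 n i1 i2 i3 i4 i5 i6 : uniq [:: i6; i5; i4; i3; i2; i1] ->
  indep_block P [set w | N w = n] X mu [:: i6; i5; i4; i3; i2; i1]
    (fun w => (X i1 w, X i2 w, X i3 w, X i4 w, X i5 w, X i6 w))
    (mu \x mu \x mu \x mu \x mu \x mu)%E.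
Proof.
rewrite cons_uniq => /andP[n6]; rewrite cons_uniq => /andP[n5 n4].
apply: indep_blockS => //.
  by do 4 apply: measurable_fun_pair => //.
apply: indep_blockS => //; first by do 3 apply: measurable_fun_pair => //.
exact: block4.
Qed.

Lemma poisson_ustat_covariance :
  (\int[P]_w (ustat4 f (X ^~ w) (N w))%:E * \int[P]_w (ustat2 g (X ^~ w) (N w))%:E
   <= \int[P]_w (ustat4 f (X ^~ w) (N w) * ustat2 g (X ^~ w) (N w))%:E).
Proof.
have e20 : 0 <= e2 by apply: integral_ge0 => x _; rewrite lee_fin.
have e40 : 0 <= e4 by apply: integral_ge0 => x _; rewrite lee_fin.
have X4 i1 i2 i3 i4 : measurable_fun setT
    (fun w => (X i1 w, X i2 w, X i3 w, X i4 w)).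
  by do 3 apply: measurable_fun_pair => //.
have X2 i1 i2 : measurable_fun setT (fun w => (X i1 w, X i2 w)).
  exact: measurable_fun_pair.
have -> : \int[P]_w (ustat4 f (X ^~ w) (N w))%:E = (t ^+ 4)%:E * e4.
  apply: (@integral_poisson_sum _ _ _ P N t t0 mN PN
    (fun n => ('I_n * 'I_n * 'I_n * 'I_n)%type) distinct4 (fun n q w =>
    f (X q.1.1.1 w, X q.1.1.2 w, X q.1.2 w, X q.2 w)) 4 e4) => //.
  - exact: card_distinct4.
  - by move=> n q; apply: measurableT_comp.
  - move=> n q Qq.
    apply: (indep_block_integral (mN n) (X4 _ _ _ _)
      (@block4 n q.1.1.1 q.1.1.2 q.1.2 q.2 _) (h := EFin \o f)).
    + by move: Qq; rewrite /distinct4 -(map_inj_uniq val_inj).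
    + exact/measurable_EFinP.
    + by move=> x; rewrite lee_fin.
have -> : \int[P]_w (ustat2 g (X ^~ w) (N w))%:E = (t ^+ 2)%:E * e2.
  apply: (@integral_poisson_sum _ _ _ P N t t0 mN PN
    (fun n => ('I_n * 'I_n)%type) distinct2 (fun n q w =>
    g (X q.1 w, X q.2 w)) 2 e2) => //.
  - exact: card_distinct2.
  - by move=> n q; apply: measurableT_comp.
  - move=> n q Qq.
    apply: (indep_block_integral (mN n) (X2 _ _)
      (@block2 n q.1 q.2 _) (h := EFin \o g)).
    + by move: Qq; rewrite /distinct2 -(map_inj_uniq val_inj).
    + exact/measurable_EFinP.
    + by move=> x; rewrite lee_fin.
(* The product of expectations is read back as one expectation: [t ^ (4 + 2)] times the integral of
   the product kernel is the mean of the sum over [distinct6]. *)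
rewrite muleACA -EFinM -exprD.
rewrite -(@integral_prod_mul2 _ _ _ _ _ (mu \x mu \x mu \x mu)%E)//.
pose h n (p : ('I_n * 'I_n * 'I_n * 'I_n) * ('I_n * 'I_n)) w :=
  (f (X p.1.1.1.1 w, X p.1.1.1.2 w, X p.1.1.2 w, X p.1.2 w) *
   g (X p.2.1 w, X p.2.2 w))%R.
have mh n p : measurable_fun setT (@h n p).
  by apply: measurable_funM; exact: measurableT_comp.
have h0 n p w : (0 <= @h n p w)%R by exact: mulr_ge0.
rewrite -(@integral_poisson_sum _ _ _ P N t t0 mN PN
  (fun n => (('I_n * 'I_n * 'I_n * 'I_n) * ('I_n * 'I_n))%type)
  distinct6 h (4 + 2))//.
- have m6 : measurable_fun setT
    (fun w => (\sum_(p | @distinct6 (N w) p) h (N w) p w)%:E).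
    apply: (@measurable_fun_poisson_mixture _ _ _ _ mN
      (fun n w => (\sum_(p | @distinct6 n p) h n p w)%:E)) => n.
    apply/measurable_EFinP.
    under eq_fun do rewrite -big_filter.
    exact: measurable_sum.
  have mU : measurable_fun setT (fun w =>
      (ustat4 f (X ^~ w) (N w) * ustat2 g (X ^~ w) (N w))%:E).
    apply: (@measurable_fun_poisson_mixture _ _ _ _ mN
      (fun n w => (ustat4 f (X ^~ w) n * ustat2 g (X ^~ w) n)%:E)) => n.
    apply/measurable_EFinP; apply: measurable_funM;
      rewrite /ustat4 /ustat2; under eq_fun do rewrite -big_filter;
      by apply: measurable_sum => i; exact: measurableT_comp.
  apply: ge0_le_integral => //; first by move=> w _; rewrite lee_fin sumr_ge0.
  (* the terms in which the four-tuple and the pair overlap are dropped *)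
  move=> w _; rewrite lee_fin /ustat4 /ustat2 big_distrlr/= pair_big_dep/=.
  rewrite big_mkcond [leRHS]big_mkcond/=; apply: ler_sum => -[[[[a b] c] e] [i j]] _.
  case: ifPn => [|_]; last by case: ifP => // _; exact: mulr_ge0.
  rewrite /distinct6 /distinct4 /distinct2 /= !inE !negb_or.
  by move=> /and3P[/and5P[-> _ _ _ _] _ ->].
- exact: card_distinct6.
- by apply: integral_ge0 => x _; rewrite lee_fin mulr_ge0.
- move=> n q Qq.
  apply: (indep_block_integral (mN n) _
      (@block6 n q.1.1.1.1 q.1.1.1.2 q.1.1.2 q.1.2 q.2.1 q.2.2 _)
      (h := fun x => (f x.1.1 * g (x.1.2, x.2))%:E)).
  + by do 5 apply: measurable_fun_pair => //.
  + by move: Qq; rewrite /distinct6 -(map_inj_uniq val_inj).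
  + apply/measurable_EFinP/measurable_funM.
    * by apply: measurableT_comp => //; exact: measurableT_comp.
    * apply: measurableT_comp => //; apply: measurable_fun_pair => //.
      exact: measurableT_comp.
  + by move=> x; rewrite lee_fin mulr_ge0.
Qed.

End poisson_covariance.

(** * Measurability of crossings *)

Section euclidean.
Context {R : realType} {d : nat}.
Implicit Types (u v x : 'rV[R]_d).

Lemma dotvE u v : dotv u v = (u *m v^T) 0 0.
Proof. by rewrite mxE; apply: eq_bigr => j _; rewrite mxE. Qed.

Lemma dotv_ge0 u : 0 <= dotv u u.
Proof. by apply: sumr_ge0 => j _; rewrite -expr2 sqr_ge0. Qed.

Lemma dotv_eq0 u : dotv u u = 0 -> u = 0.
Proof.
move=> u0; apply/rowP => j; rewrite mxE.
have /(_ j isT)/eqP := psumr_eq0P (fun j _ => sqr_ge0 (u 0 j)) u0.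
by rewrite sqrf_eq0 => /eqP.
Qed.

Lemma dotvBl u v x : dotv (u - v) x = dotv u x - dotv v x.
Proof. by rewrite /dotv -sumrB; apply: eq_bigr => j _; rewrite !mxE mulrBl. Qed.

(* With [B] a basis of the row space of [L], the orthogonal projection is
   given by the matrix [B^T (B B^T)^-1 B]. *)
Lemma oproj_mulmx (L : 'M[R]_d) :
  {Q : 'M[R]_d | forall x, oproj L x = x *m Q}.
Proof.
pose B := row_base L; pose G := B *m B^T.
(* [G] is the Gram matrix of independent rows: [u *m G = 0] makes the squared norm of [u *m B]
   vanish, hence [u = 0]. *)
have Gunit : G \in unitmx.
  rewrite -row_free_unit; apply: inj_row_free => u uG0.
  suff uB0 : u *m B = 0.
    by apply/eqP; rewrite -(mulmx_free_eq0 u (row_base_free L)) uB0.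
  apply: dotv_eq0.
  by rewrite dotvE trmx_mul mulmxA -(mulmxA u) uG0 mul0mx mxE.
pose Q := B^T *m invmx G *m B; exists Q => x.
have qL : (x *m Q <= L)%MS.
  by rewrite mulmxA (submx_trans (submxMl _ _))// eq_row_base.
have xq v : (v <= L)%MS -> dotv (x - x *m Q) v = 0.
  rewrite -(eq_row_base L) => /submxP[y ->]; rewrite -/B.
  have -> : (x - x *m Q) = x *m (1%:M - Q) by rewrite mulmxBr mulmx1.
  rewrite dotvE trmx_mul -mulmxA (mulmxA _ B^T) mulmxBl mul1mx.
  by rewrite -(mulmxA _ B) -/G mulmxKV// subrr mul0mx mulmx0 mxE.
(* For another candidate [p], the vector [p - x *m Q] lies in [L] and is a difference of two vectors
   orthogonal to [L], so it is orthogonal to itself. *)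
apply: xget_unique => // p [pL xp].
apply/eqP; rewrite -subr_eq0; apply/eqP; apply: dotv_eq0.
have pqL : (p - x *m Q <= L)%MS by rewrite addmx_sub// eqmx_opp.
have {1}-> : p - x *m Q = (x - x *m Q) - (x - p).
  by rewrite opprB [RHS]addrC addrA subrK.
by rewrite dotvBl xq// xp// subrr.
Qed.

End euclidean.

Section borel.
Context {R : realType} {d : nat}.

Definition vec_borel := g_sigma_algebraType
  [set @box R d a b | a in [set: 'rV[R]_d] & b in [set: 'rV[R]_d]].
Notation T := vec_borel.

Lemma vec_borel2E (A : set (T * T)) : measurable A = borel_dd A.
Proof. by rewrite measurable_prod_measurableType. Qed.

Lemma measurable_coord (j : 'I_d) : measurable_fun setT (fun x : T => x 0 j : R).
Proof.
apply: (measurability (@RGenInftyO.G R)); first exact: RGenInftyO.measurableE.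
move=> _ [_ [c ->] <-]; rewrite setTI.
(* The half-space is exhausted by boxes with all lower bounds [-n] and upper bounds [n], except [c]
   in direction [j]. Bounding the sum of all absolute coordinates yields one [n] for every
   direction. *)
have -> : (fun x : T => x 0 j : R) @^-1` `]-oo, c[ = \bigcup_n
    @box R d (const_mx (- n%:R)) (\row_k if k == j then c else n%:R).
  apply/seteqP; split => x /=; rewrite in_itv/=.
    move=> xc; pose n := Num.bound (\sum_k `|x 0 k|).
    have xn k : `|x 0 k| < n%:R.
      apply: le_lt_trans (archi_boundP _); last exact: sumr_ge0.
      by rewrite (bigD1 k)//= lerDl sumr_ge0.
    exists n => // k; rewrite !mxE; move: (xn k); rewrite ltr_norml => /andP[/ltW -> /=].
    by case: eqP => [->|].
  by move=> [n _] /(_ j); rewrite !mxE eqxx => /andP[].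
apply: bigcup_measurable => n _; apply: sub_sigma_algebra.
by exists (const_mx (- n%:R)) => //; eexists.
Qed.

Lemma measurable_mulmx_coord dS (S : measurableType dS) (F : S -> 'rV[R]_d)
    (Q : 'M[R]_d) :
  (forall k, measurable_fun setT (fun x => F x 0 k)) ->
  forall j, measurable_fun setT (fun x => (F x *m Q) 0 j).
Proof.
move=> mF j; under eq_fun do rewrite mxE.
by apply: measurable_sum => k; apply: measurable_funM.
Qed.

Lemma measurable_dotv dS (S : measurableType dS) (F : S -> 'rV[R]_d) :
  (forall k, measurable_fun setT (fun x => F x 0 k)) ->
  measurable_fun setT (fun x => dotv (F x) (F x)).
Proof.
by move=> mF; apply: measurable_sum => k; apply: measurable_funM.
Qed.

Lemma measurable_enorm dS (S : measurableType dS) (F : S -> 'rV[R]_d) :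
  (forall k, measurable_fun setT (fun x => F x 0 k)) ->
  measurable_fun setT (fun x => enorm (F x)).
Proof.
move=> mF; apply: measurableT_comp; last exact: measurable_dotv.
exact: continuous_measurable_fun (@sqrt_continuous R).
Qed.

Lemma measurable_coordB dS (S : measurableType dS) (F G : S -> 'rV[R]_d) :
  (forall k, measurable_fun setT (fun x => F x 0 k)) ->
  (forall k, measurable_fun setT (fun x => G x 0 k)) ->
  forall k, measurable_fun setT (fun x => (F x - G x) 0 k).
Proof.
move=> mF mG k; under eq_fun do rewrite !mxE.
exact: measurable_funB.
Qed.

Lemma measurable_indR dS (S : measurableType dS) (A : S -> Prop) :
  measurable [set x | A x] ->
  measurable_fun setT (fun x => indR (A x) : R).
Proof.
move=> mA; rewrite (_ : (fun x => _) = \1_[set x | A x]).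
  exact: measurable_indic.
apply/funext => x; rewrite indicE /indR.
by case: asboolP => [Ax|nAx]; [rewrite mem_set|rewrite memNset].
Qed.

Lemma indR_ge0 (A : Prop) : 0 <= indR A :> R.
Proof. by rewrite /indR; case: ifP. Qed.

End borel.

Section crossing.
Context {R : realType}.

(** The rational must stay in the unit interval: it is taken between [s] and 1 if [s < 1], while
    [s = 1] is itself rational. *)
Lemma rat_approx01 (s e : R) : 0 <= s <= 1 -> 0 < e ->
  exists2 q : rat, 0 <= (ratr q : R) <= 1 & `|s - ratr q| < e.
Proof.
move=> /andP[s0 s1] e0; have [s_lt1|s_ge1] := ltP s 1.
  have : s < Num.min (s + e) 1 by rewrite lt_min ltrDl e0 s_lt1.
  move=> /rat_in_itvoo[q]; rewrite in_itv/= lt_min => /and3P[sq qe q1].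
  exists q; first by rewrite (le_trans s0 (ltW sq)) ltW.
  by rewrite distrC gtr0_norm ?subr_gt0// ltrBlDl.
exists 1%:Q; first by rewrite rmorph1 ler01 lexx.
have -> : s = 1 by apply/eqP; rewrite eq_le s1.
by rewrite rmorph1 subrr normr0.
Qed.

(* Turns an existential over a continuum into countably many conditions, which
   makes the crossing event measurable. *)
Lemma vanish_on_square (phi : R * R -> R) : continuous phi ->
  (forall z, 0 <= phi z) ->
  (exists s r, [/\ 0 <= s <= 1, 0 <= r <= 1 & phi (s, r) = 0]) <->
  (forall n : nat, exists p q : rat, [/\ 0 <= (ratr p : R) <= 1,
    0 <= (ratr q : R) <= 1 & phi (ratr p, ratr q) < n.+1%:R^-1]).
Proof.
move=> cphi phi0; split.
  move=> [s [r [s01 r01 sr0]]] n.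
  have : \forall z \near nbhs (s, r), phi z < n.+1%:R^-1.
    have n0 : 0 < n.+1%:R^-1 :> R by rewrite invr_gt0.
    have := cphi (s, r); rewrite /continuous_at sr0 => /cvgrPdist_lt/(_ _ n0).
    apply: filterS => z; rewrite sub0r normrN => zn.
    exact: le_lt_trans (ler_norm _) zn.
  move=> /nbhs_ballP[e /= e0 He].
  have [p p01 sp] := rat_approx01 s01 e0.
  have [q q01 rq] := rat_approx01 r01 e0.
  exists p, q; split => //; apply: He; split => //=.
move=> H.
(* By compactness the image of the square is closed; the rational points make 0 adherent to it, so 0
   is attained. *)
pose K : set (R * R) := `[0, 1] `*` `[0, 1].
have cK : compact K by apply: compact_setX; exact: segment_compact.
have : closed (phi @` K).
  apply: compact_closed => //; apply: continuous_compact => //.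
  exact: continuous_subspaceT.
move=> /(_ 0)[].
  move=> B /nbhs_ballP[e /= e0 He].
  have [n ne] : exists n : nat, n.+1%:R^-1 < e.
    exists (Num.bound e^-1); rewrite invf_plt ?posrE//.
    rewrite (lt_trans (archi_boundP _))// ?ltr_nat//.
    by rewrite invr_ge0 ltW.
  have [p [q [p01 q01 pq]]] := H n.
  exists (phi (ratr p, ratr q)); split.
    by exists (ratr p, ratr q) => //; split; rewrite /= in_itv.
  apply: He; rewrite /ball/= sub0r normrN ger0_norm//; exact: lt_trans ne.
move=> [s r] [/= + +] sr0; rewrite !in_itv/= => s01 r01.
by exists s, r.
Qed.

Context {d : nat}.
Notation T := (@vec_borel R d).

Lemma continuous_affine_dotv (A B C : 'rV[R]_d) : continuous
  (fun z : R * R => dotv (A + z.1 *: B + z.2 *: C) (A + z.1 *: B + z.2 *: C)).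
Proof.
rewrite /dotv; apply: continuous_big => [|j _]; first exact: add_continuous.
have c k : continuous (fun z : R * R => (A + z.1 *: B + z.2 *: C) 0 k).
  under eq_fun do rewrite !mxE.
  move=> z; apply: cvgD; first apply: cvgD; first exact: cvg_cst.
    by apply: cvgM; [exact: cvg_fst|exact: cvg_cst].
  by apply: cvgM; [exact: cvg_snd|exact: cvg_cst].
by move=> z; apply: cvgM; exact: c.
Qed.

(** [phi v (s, r)] is the squared distance between the projected points at parameters [s] and [r] of
    the two segments; a crossing is a zero of it on the unit square. [vanish_on_square] turns this
    into countably many strict inequalities, each measurable in [v]. *)
Lemma measurable_proj_cross (L : 'M[R]_d) :
  measurable [set v : T * T * T * T | proj_cross L v.1.1.1 v.1.1.2 v.1.2 v.2].
Proof.
have [Q oprojE] := oproj_mulmx L.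
pose aff (v : T * T * T * T) (z : R * R) :=
  ((v.1.1.1 : 'rV[R]_d) - v.1.2) *m Q
    + z.1 *: (((v.1.1.2 : 'rV[R]_d) - v.1.1.1) *m Q)
    + z.2 *: (((v.1.2 : 'rV[R]_d) - v.2) *m Q).
pose phi v z := dotv (aff v z) (aff v z).
have crossE v : proj_cross L v.1.1.1 v.1.1.2 v.1.2 v.2 <->
    exists s r, [/\ 0 <= s <= 1, 0 <= r <= 1 & phi v (s, r) = 0].
  case: v => [[[a b] c] e] /=.
  have E s r : (a - c) *m Q + s *: ((b - a) *m Q) + r *: ((c - e) *m Q) =
      ((1 - s) *: a + s *: b) *m Q - ((1 - r) *: c + r *: e) *m Q.
    rewrite !scalemxAl -!mulmxDl -mulmxBl; congr (_ *m _).
    by apply/rowP => k; rewrite !mxE; ring.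
  split.
    move=> [y [[_ [s s01 <-] <-] [_ [r r01 <-]]]]; rewrite !oprojE => yE.
    exists s, r; split => //; rewrite /phi /aff/= E yE subrr.
    by rewrite /dotv big1// => k _; rewrite mxE mul0r.
  move=> [s [r [s01 r01]]]; rewrite /phi /aff/= => /dotv_eq0.
  rewrite E => /eqP; rewrite subr_eq0 => /eqP sr.
  exists (oproj L ((1 - s) *: a + s *: b)); split.
    by exists ((1 - s) *: a + s *: b) => //; exists s.
  exists ((1 - r) *: c + r *: e); first by exists r.
  by rewrite !oprojE sr.
have -> : [set v : T * T * T * T | proj_cross L v.1.1.1 v.1.1.2 v.1.2 v.2] =
    \bigcap_n \bigcup_(pq in [set pq : rat * rat |
      (0 <= (ratr pq.1 : R) <= 1) /\ (0 <= (ratr pq.2 : R) <= 1)])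
      [set v | phi v (ratr pq.1, ratr pq.2) < n.+1%:R^-1].
  apply/seteqP; split => v /=.
    move=> /crossE/vanish_on_square H n _.
    have [|z|p [q [? ? ?]]] := H _ _ n; first exact: continuous_affine_dotv.
      exact: dotv_ge0.
    by exists (p, q).
  move=> H; apply/crossE/vanish_on_square => [|z|n].
  - exact: continuous_affine_dotv.
  - exact: dotv_ge0.
  by have [[p q] [? ?] ?] := H n Logic.I; exists p, q.
apply: bigcapT_measurable => n; rewrite bigcup_mkcond.
apply: countable_bigcupT_measurable => // -[p q]; case: ifP => // _.
rewrite -[X in measurable X]setTI.
have mphi : measurable_fun setT (phi ^~ (ratr p, ratr q)).
  have m1 k : measurable_fun setT (fun v : T * T * T * T => (v.1.1.1 : 'rV[R]_d) 0 k).
    apply: (measurableT_comp (measurable_coord k)).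
    by do 2 apply: measurableT_comp => //.
  have m2 k : measurable_fun setT (fun v : T * T * T * T => (v.1.1.2 : 'rV[R]_d) 0 k).
    apply: (measurableT_comp (measurable_coord k)).
    by do 2 apply: measurableT_comp => //.
  have m3 k : measurable_fun setT (fun v : T * T * T * T => (v.1.2 : 'rV[R]_d) 0 k).
    apply: (measurableT_comp (measurable_coord k)).
    by apply: measurableT_comp.
  have m4 k : measurable_fun setT (fun v : T * T * T * T => (v.2 : 'rV[R]_d) 0 k).
    exact: (measurableT_comp (measurable_coord k)).
  apply: (@measurable_dotv _ _ _ _ (aff ^~ (ratr p, ratr q))) => k.
  have coordE (A B C : 'rV[R]_d) x y :
      (A + x *: B + y *: C) 0 k = A 0 k + x * B 0 k + y * C 0 k.
    by rewrite !mxE.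
  apply: (eq_measurable_fun (fun v : T * T * T * T =>
      (((v.1.1.1 : 'rV[R]_d) - v.1.2) *m Q) 0 k
    + ratr p * (((v.1.1.2 : 'rV[R]_d) - v.1.1.1) *m Q) 0 k
    + ratr q * (((v.1.2 : 'rV[R]_d) - v.2) *m Q) 0 k)).
    by move=> v _; rewrite /aff coordE.
  apply: measurable_funD; first apply: measurable_funD.
  - by apply: measurable_mulmx_coord => l; exact: measurable_coordB.
  - apply: measurable_funM => //.
    by apply: measurable_mulmx_coord => l; exact: measurable_coordB.
  - apply: measurable_funM => //.
    by apply: measurable_mulmx_coord => l; exact: measurable_coordB.
have := mphi measurableT `]-oo, n.+1%:R^-1[%classic (measurable_itv _).
by rewrite (_ : _ @^-1` _ = [set v | phi v (ratr p, ratr q) < n.+1%:R^-1])//;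
  apply/seteqP; split => v /=; rewrite in_itv.
Qed.

End crossing.

(** * The Poisson process on [W] *)

Section volume.
Context {R : realType} {d : nat}.
Hypothesis d0 : (0 < d)%N.
Implicit Types (A W : set 'rV[R]_d) (a b : 'rV[R]_d).

Lemma boxvol_ge0 a b : 0 <= boxvol a b.
Proof. by apply: prodr_ge0 => j _; rewrite le_max lexx orbT. Qed.

Lemma vol_d_le_boxvol A a b : A `<=` box a b -> (vol_d A <= (boxvol a b)%:E)%E.
Proof.
move=> Aab; apply: ereal_inf_lbound => /=.
(* The cover is padded with copies of [box 0 0], of volume 0 because [d > 0] (an empty product would
   be 1). *)
exists (fun k => if (k == 0)%N then a else 0), (fun k => if (k == 0)%N then b else 0).
split; first by move=> x /Aab xab; exists 0%N.
rewrite (nneseries_split 0 1) => [|k _]; last first.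
  by rewrite lee_fin boxvol_ge0.
rewrite big_nat1 eseries0 ?adde0// => -[//|k] _ _; congr EFin.
rewrite /boxvol; pose j0 := Ordinal d0.
by rewrite (bigD1 j0)//= subrr maxxx mul0r.
Qed.

Lemma compact_sub_cube W : compact W ->
  exists2 M : R, 0 < M & forall x, W x -> forall k, - M <= x 0 k < M.
Proof.
move=> /compact_bounded[M [Mreal WM]].
(* Norms are bounded by every real strictly above [M], such as [|M| + 1]; the second unit makes the
   upper inequality strict, as half-open boxes require. *)
exists (`|M| + 2); first by rewrite ltr_wpDl.
move=> x Wx k.
have : `|x| <= `|M| + 1.
  by apply: WM => //; rewrite (le_lt_trans (ler_norm M))// ltrDl.
have -> : `|x| = \big[Num.max/0]_i `|x i.1 i.2| by rewrite -mx_normrE.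
move=> xM; have : `|x 0 k| <= `|M| + 1.
  by apply: le_trans xM; apply: (le_bigmax _ (fun i => `|x i.1 i.2|) (0, k)).
rewrite ler_norml => /andP[xl xr]; apply/andP; split.
  by rewrite (le_trans _ xl)// lerN2 lerD2l ler1n.
by rewrite (le_lt_trans xr)// ltrD2l ltr1n.
Qed.

(* The cube is cut into [m + 1] slabs of equal width along the first
   coordinate. *)
Lemma compact_slabs W : compact W ->
  exists (C : R) (S : nat -> nat -> set 'rV[R]_d), [/\
    forall m k, borel_d (S m k),
    forall m k, (vol_d (S m k `&` W) <= (C / m.+1%:R)%:E)%E &
    forall m x, W x -> exists2 k, (k < m.+1)%N & S m k x].
Proof.
move=> /compact_sub_cube[M M0 WM]; pose j0 := Ordinal d0.
pose h m : R := (2 * M) / m.+1%:R.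
have h0 m : 0 < h m by rewrite divr_gt0// mulr_gt0.
pose a m k : 'rV[R]_d :=
  \row_j (if j == j0 then - M + k%:R * h m else - M).
pose b m k : 'rV[R]_d :=
  \row_j (if j == j0 then - M + k.+1%:R * h m else M).
(* [C] is the volume of the cube; a slab has width [h m] in one direction and [2 * M] in the others,
   hence volume [C / m.+1]. *)
exists (\prod_(j < d) (2 * M)), (fun m k => box (a m k) (b m k)); split.
- move=> m k; apply: sub_sigma_algebra.
  by exists (a m k) => //; exists (b m k).
- move=> m k; apply: le_trans (vol_d_le_boxvol (@subIsetl _ _ _)) _.
  rewrite lee_fin /boxvol (bigD1 j0)//= [in leRHS](bigD1 j0)//=.
  rewrite !mxE eqxx (_ : _ - _ = h m); last by rewrite -natr1; ring.
  rewrite max_l ?(ltW (h0 m))// [leRHS]mulrAC ler_pM2l ?h0//.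
  rewrite le_eqVlt; apply/orP; left; apply/eqP; apply: eq_bigr => j /negbTE jj0.
  by rewrite !mxE jj0 opprK max_l; [ring|rewrite addr_ge0 ?ltW].
move=> m x Wx; have /andP[xl xr] := WM x Wx j0.
pose y := (x 0 j0 + M) / h m.
have y0 : 0 <= y by rewrite divr_ge0 ?(ltW (h0 m))// -(opprK M) subr_ge0.
have /andP[yl yr] := truncn_itv y0.
exists (Num.truncn y).
  rewrite truncn_lt_nat// ltr_pdivrMr// /h mulrCA divff ?pnatr_eq0// mulr1.
  by rewrite -[2]/(1 + 1) mulrDl mul1r ltrD2r.
move=> k; rewrite !mxE; case: eqP => [->|_]; last exact: WM.
move: yl yr; rewrite ler_pdivlMr// ltr_pdivrMr// => yl yr.
by apply/andP; split; rewrite addrC -?lerBrDr -?ltrBlDr ?opprK// lerBlDr.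
Qed.

End volume.

Section poisson_process.
Context (R : realType) (d : nat) (d0 : (0 < d)%N)
  (W : set 'rV[R]_d) (t : R) (dO : measure_display) (O : measurableType dO)
  (P : probability O R) (N : O -> nat) (X : nat -> O -> 'rV[R]_d).
Hypothesis hV : poisson_pp P t W N X.
Notation T := (@vec_borel R d).

Lemma poisson_pp_measurable i : measurable_fun setT (X i : O -> T).
Proof. by case: hV => _ mX _ _ _ _ A mA; rewrite setTI; exact: mX. Qed.

(** The definition of the process covers only initial segments of indices. An arbitrary [l] is
    embedded in one, with the whole space as event at each index outside [l]. *)
Lemma poisson_pp_indep (B : set nat) (l : seq nat) (A : nat -> set 'rV[R]_d) :
  uniq l -> (forall i, borel_d (A i)) ->
  P ([set w | B (N w)] `&` \big[setI/setT]_(i <- l) (X i @^-1` A i))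
  = (P [set w | B (N w)] * \prod_(i <- l) P (X i @^-1` A i))%E.
Proof.
case: hV => _ _ _ _ indX ul mA.
pose n := (\max_(i <- l) i).+1.
have ln i : i \in l -> (i < n)%N by move=> il; rewrite ltnS leq_bigmax_seq.
pose A' i := if i \in l then A i else setT.
have mA' i : borel_d (A' i).
  by rewrite /A'; case: ifP => // _; exact: (@measurableT _ T).
have := indX n B A' mA'.
have -> : \bigcap_(i in [set i | (i < n)%N]) (X i @^-1` A' i) =
    \big[setI/setT]_(i <- l) (X i @^-1` A i).
  rewrite -bigcap_seq; apply/seteqP; split => w /= H i /=.
    by move=> il; have := H i (ln i il); rewrite /A' il.
  by move=> _; rewrite /A'; case: ifP => // il; exact: H.
move=> ->; congr (_ * _)%E.
rewrite -(big_mkord xpredT (fun i => P (X i @^-1` A' i))).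
rewrite (bigID (mem l))/= [X in (_ * X)%E]big1 ?mule1; last first.
  by move=> i /negbTE il; rewrite /A' il preimage_setT probability_setT.
rewrite -big_filter (perm_big l); last first.
  apply: uniq_perm => //; first by rewrite filter_uniq// iota_uniq.
  move=> i; rewrite mem_filter mem_index_iota /=.
  by case: (boolP (i \in l)) => //= /ln.
by apply: eq_big_seq => i il; rewrite /A' il.
Qed.

Hypothesis cW : compact W.

(** A tie inside [W] puts both points into the same slab at every scale [m]. By independence and the
    union bound this costs at most [m.+1 * (C / m.+1) ^+ 2 = C ^+ 2 / m.+1], which tends to 0; [Z]
    is the intersection over all scales. *)
Lemma poisson_pp_no_ties i j : i != j ->
  exists Z, [/\ measurable Z, P Z = 0%E &
    forall w, W (X i w) -> X i w = X j w -> Z w].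
Proof.
move=> ij; have [C [S [mS volS WS]]] := compact_slabs d0 cW.
have [_ mX _ PX _] := hV.
pose Y m k := (X i @^-1` S m k) `&` (X j @^-1` S m k).
have mY m k : measurable (Y m k) by apply: measurableI; exact: mX.
pose U m := \big[setU/set0]_(k < m.+1) Y m k.
have mU m : measurable (U m) by exact: bigsetU_measurable.
have PY m k : P (Y m k) = (P (X i @^-1` S m k) * P (X j @^-1` S m k))%E.
  have := @poisson_pp_indep setT [:: i; j] (fun=> S m k).
  rewrite /= inE ij => /(_ erefl (fun=> mS m k)).
  have -> : [set w | [set: nat] (N w)] = setT by apply/seteqP.
  by rewrite !big_cons !big_nil mule1 setIT setTI probability_setT mul1e.
have PYle m k : (P (Y m k) <= ((C / m.+1%:R) ^+ 2)%:E)%E.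
  by rewrite PY !PX// expr2 EFinM; apply: lee_pmul => //; rewrite -(PX i).
have PU m : (P (U m) <= (C ^+ 2 / m.+1%:R)%:E)%E.
  apply: le_trans (Boole_inequality P (fun k _ => mY m k)) _.
  apply: (@le_trans _ _ (\sum_(k < m.+1) ((C / m.+1%:R) ^+ 2)%:E)%E).
    by apply: lee_sum => k _; exact: PYle.
  rewrite sumEFin lee_fin sumr_const card_ord -mulr_natr.
  have m0 : m.+1%:R != 0 :> R by rewrite pnatr_eq0.
  by rewrite le_eqVlt; apply/orP; left; apply/eqP; field.
have mZ : measurable (\bigcap_m U m) by exact: bigcapT_measurable.
exists (\bigcap_m U m); split => //.
  apply/eqP; rewrite eq_le measure_ge0 andbT.
  have PZ m : (P (\bigcap_m U m) <= (C ^+ 2 / m.+1%:R)%:E)%E.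
    apply: le_trans (PU m); apply: le_measure; rewrite ?inE//.
    exact: bigcap_inf.
  have Zfin : P (\bigcap_m U m) \is a fin_num by exact: fin_num_measure.
  move: PZ; rewrite -(fineK Zfin); set r := fine _ => Pr; rewrite lee_fin.
  rewrite leNgt; apply/negP => r0.
  have := Pr (Num.bound (C ^+ 2 / r)); rewrite lee_fin leNgt => /negP; apply.
  rewrite ltr_pdivrMr// mulrC -ltr_pdivrMr//.
  rewrite (lt_trans (archi_boundP _))// ?ltr_nat//.
  by rewrite divr_ge0// ?sqr_ge0// ltW.
move=> w WX XX m _; have [k km Sk] := WS m _ WX.
rewrite /U -bigcup_mkord; exists k => //; split => //=.
by rewrite -XX.
Qed.

End poisson_process.

(** * Kernels of the two graph statistics, and passage from vertices to indices *)

Section statistics.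
Context {R : realType} {d : nat}.
Notation T := (@vec_borel R d).

Lemma sum_vertex_seq n (X : nat -> 'rV[R]_d) (F : 'rV[R]_d -> R) :
  \sum_(v <- [seq X i | i <- iota 0 n]) F v = \sum_(i < n) F (X i).
Proof. rewrite -(big_mkord xpredT (fun i => F (X i))) /index_iota subn0.
by rewrite big_map. Qed.

Definition cross_kernel (L : 'M[R]_d) (delta : R) (v : T * T * T * T) : R :=
  8^-1 * (indR (proj_cross L v.1.1.1 v.1.1.2 v.1.2 v.2) *
  indR (enorm ((v.1.1.1 : 'rV[R]_d) - v.1.1.2) <= delta) *
  indR (enorm ((v.1.2 : 'rV[R]_d) - v.2) <= delta)).

(* [w] is only controlled on [W `*` W], hence the truncation. *)
Definition stress_kernel (W : set 'rV[R]_d) (L : 'M[R]_d)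
    (w : 'rV[R]_d -> 'rV[R]_d -> R) (v : T * T) : R :=
  2^-1 * (((fun p => w p.1 p.2) \_ (W `*` W)) v *
  (enorm ((v.1 : 'rV[R]_d) - v.2) - enorm (oproj L v.1 - oproj L v.2)) ^+ 2).

Lemma measurable_indR_le dS (S : measurableType dS) (F : S -> R) (c : R) :
  measurable_fun setT F -> measurable_fun setT (fun x => indR (F x <= c) : R).
Proof.
move=> mF; apply: measurable_indR; rewrite -[X in measurable X]setTI.
have := mF measurableT `]-oo, c]%classic (measurable_itv _).
by rewrite (_ : _ @^-1` _ = [set x | F x <= c])//;
  apply/seteqP; split => x /=; rewrite in_itv.
Qed.

Lemma measurable_cross_kernel L delta :
  measurable_fun setT (cross_kernel L delta).
Proof.
apply: measurable_funM => //; apply: measurable_funM.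
  apply: measurable_funM.
    by apply: measurable_indR; exact: measurable_proj_cross.
  apply: measurable_indR_le; apply: measurable_enorm.
  apply: measurable_coordB => k; apply: (measurableT_comp (measurable_coord k));
    by do 2 apply: measurableT_comp => //.
apply: measurable_indR_le; apply: measurable_enorm.
apply: measurable_coordB => k;
  apply: (measurableT_comp (measurable_coord k)) => //;
  exact: measurableT_comp.
Qed.

Lemma measurable_weight_domain (W : set 'rV[R]_d)
    (w : 'rV[R]_d -> 'rV[R]_d -> R) :
  (forall B : set R, measurable B ->
    borel_dd ((W `*` W) `&` [set p | B (w p.1 p.2)])) ->
  measurable (W `*` W : set (T * T)).
Proof.
move=> /(_ setT measurableT); rewrite vec_borel2E.
by rewrite (_ : [set p | _] = setT) ?setIT//; apply/seteqP; split.
Qed.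

Lemma measurable_stress_kernel (W : set 'rV[R]_d) L
    (w : 'rV[R]_d -> 'rV[R]_d -> R) :
  (forall B : set R, measurable B ->
    borel_dd ((W `*` W) `&` [set p | B (w p.1 p.2)])) ->
  measurable_fun setT (stress_kernel W L w).
Proof.
move=> mw.
have mWW := measurable_weight_domain mw.
have [Q oprojE] := oproj_mulmx L.
have m1 k : measurable_fun setT (fun v : T * T => (v.1 : 'rV[R]_d) 0 k).
  exact: (measurableT_comp (measurable_coord k)).
have m2 k : measurable_fun setT (fun v : T * T => (v.2 : 'rV[R]_d) 0 k).
  exact: (measurableT_comp (measurable_coord k)).
apply: measurable_funM => //; apply: measurable_funM.
  apply/(measurable_restrictT _ mWW) => _ B mB; rewrite vec_borel2E.
  exact: mw.
apply: measurable_funX; apply: measurable_funB.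
  by apply: measurable_enorm; exact: measurable_coordB.
rewrite (_ : (fun v : T * T => enorm (oproj L v.1 - oproj L v.2)) =
  (fun v => enorm ((v.1 : 'rV[R]_d) *m Q - (v.2 : 'rV[R]_d) *m Q))); last first.
  by apply/funext => v; rewrite !oprojE.
apply: measurable_enorm; apply: measurable_coordB;
  exact: measurable_mulmx_coord.
Qed.

Context (n : nat) (x : nat -> T).
Hypothesis xinj : injective x.

Let vertex_seqE : vertex_seq n x = [seq x i | i <- iota 0 n].
Proof. by rewrite /vertex_seq undup_id ?map_inj_uniq ?iota_uniq. Qed.

(** The sides are swapped to match [distinct2] and [distinct4], which list indices from last to
    first. *)
Let xeq (i j : 'I_n) : (x i == x j) = (j == i).
Proof. by rewrite (inj_eq xinj) eq_sym. Qed.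

Lemma cr_bar_ustat4 L delta :
  cr_bar L delta (vertex_seq n x) = ustat4 (cross_kernel L delta) x n.
Proof.
rewrite /cr_bar vertex_seqE /ustat4 [RHS]big_mkcond/=.
rewrite -(pair_bigA _ (fun p i4 => if distinct4 (p, i4) then
  cross_kernel L delta (x p.1.1, x p.1.2, x p.2, x i4) else 0))/=.
rewrite -(pair_bigA _ (fun p i3 => \sum_i4 if distinct4 (p, i3, i4) then
  cross_kernel L delta (x p.1, x p.2, x i3, x i4) else 0))/=.
rewrite -(pair_bigA _ (fun i1 i2 => \sum_i3 \sum_i4 if distinct4 (i1, i2, i3, i4) then
  cross_kernel L delta (x i1, x i2, x i3, x i4) else 0))/=.
rewrite big_distrr/= sum_vertex_seq; apply: eq_bigr => a _.
rewrite sum_vertex_seq big_distrr/=; apply: eq_bigr => b _.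
rewrite sum_vertex_seq big_distrr/=; apply: eq_bigr => c _.
rewrite sum_vertex_seq big_distrr/=; apply: eq_bigr => e _.
rewrite /distinct4 /= !inE !negb_or !xeq.
by do 6 case: (_ == _); rewrite /= ?mulr0.
Qed.

Lemma stress_ustat2 (W : set 'rV[R]_d) L w : (forall i, W (x i)) ->
  stress L w (vertex_seq n x) = ustat2 (stress_kernel W L w) x n.
Proof.
move=> xW; rewrite /stress vertex_seqE /ustat2 [RHS]big_mkcond/=.
rewrite -(pair_bigA _ (fun i1 i2 => if distinct2 (i1, i2) then
  stress_kernel W L w (x i1, x i2) else 0))/=.
rewrite sum_vertex_seq big_distrr/=; apply: eq_bigr => a _.
rewrite sum_vertex_seq big_distrr/=; apply: eq_bigr => b _.
rewrite /distinct2 /= !inE andbT xeq; case: (_ == _); rewrite /= ?mulr0//.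
have xab : (W `*` W) (x a, x b) by split; exact: xW.
by rewrite /stress_kernel patchE (mem_set xab).
Qed.

End statistics.

Lemma cross_kernel_ge0 (R : realType) d (L : 'M[R]_d) delta v :
  0 <= cross_kernel L delta v.
Proof. by rewrite !mulr_ge0// ?indR_ge0// invr_ge0. Qed.

Lemma stress_kernel_ge0 (R : realType) d (W : set 'rV[R]_d) (L : 'M[R]_d) w v :
  (forall x y, W x -> W y -> 0 < w x y) -> 0 <= stress_kernel W L w v.
Proof.
move=> w0; apply: mulr_ge0; first by rewrite invr_ge0.
apply: mulr_ge0; last exact: sqr_ge0.
by rewrite patchE; case: ifPn => // /[!inE] -[? ?]; exact/ltW/w0.
Qed.

Unset Implicit Arguments.

Theorem theorem5 (R : realType) (d : nat) (hd : (2 <= d)%N)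
  (W : set 'rV[R]_d) (hWc : compact W) (hWconv : is_convex_set W)
  (hWvol : vol_d W = 1%E)
  (t : R) (ht : 0 < t) (delta : R) (hdelta : 0 < delta)
  (w : 'rV[R]_d -> 'rV[R]_d -> R)
  (hwpos : forall x y, W x -> W y -> 0 < w x y)
  (hwmeas : forall B : set R, measurable B ->
      borel_dd ((W `*` W) `&` [set p | B (w p.1 p.2)]))
  (L : 'M[R]_d) (hL : \rank L = 2%N)
  (dO : measure_display) (O : measurableType dO) (P : probability O R)
  (N : O -> nat) (X : nat -> O -> 'rV[R]_d)
  (hV : poisson_pp P t W N X)
  (h2 : (\int[P]_om ((stress L w (vertex_seq (N om) (fun i => X i om))) ^+ 2)%:E < +oo)%E) :
  (\int[P]_om (cr_bar L delta (vertex_seq (N om) (fun i => X i om)))%:E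
     * \int[P]_om (stress L w (vertex_seq (N om) (fun i => X i om)))%:E
   <= \int[P]_om (cr_bar L delta (vertex_seq (N om) (fun i => X i om))
                  * stress L w (vertex_seq (N om) (fun i => X i om)))%:E)%E.
Proof.
have d0 : (0 < d)%N by exact: ltnW.
have mX := poisson_pp_measurable hV.
have [mN mXA PN PX _] := hV.
(* The hypothesis on [w], at [B = setT], makes the square of [W] measurable; [W] is its section at
   one of its points, which exists since the volume is not 0. *)
have bW : borel_d W.
  have [y Wy] : W !=set0.
    apply/set0P/negP => /eqP W0.
    have /(vol_d_le_boxvol d0) : W `<=` box 0 0 by rewrite W0.
    rewrite hWvol lee_fin /boxvol; pose j0 := Ordinal d0.
    by rewrite (bigD1 j0)//= subrr maxxx mul0r ler10.
  have mWW := measurable_weight_domain hwmeas.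
  have := measurable_ysection (y : @vec_borel R d) mWW.
  by rewrite /ysection; rewrite (_ : [set x | _] = W)//; apply/seteqP; split => x /=;
    rewrite inE/=; [case|].
have PXW i : P (~` (X i @^-1` W)) = 0%E.
  rewrite probability_setC; last exact: mXA.
  by rewrite PX// setIid hWvol subee.
have /choice[Z HZ] : forall ij : nat * nat, exists Z, [/\ measurable Z, P Z = 0%E &
    ij.1 != ij.2 -> forall om, W (X ij.1 om) -> X ij.1 om = X ij.2 om -> Z om].
  move=> [i j]; have [ij|ij] := eqVneq i j.
    by exists set0; split => //=; rewrite ij eqxx.
  have [Z [mZ Z0 HZ]] := poisson_pp_no_ties d0 hV hWc ij.
  by exists Z; split.
(* All indices are included, not only those below [N], so that off [Bad] the whole sequence is
   injective with values in [W]; countability keeps [Bad] null. *)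
pose Bad := \bigcup_i (~` (X i @^-1` W)) `|` \bigcup_i \bigcup_j Z (i, j).
have mBad : measurable Bad.
  apply: measurableU; apply: bigcup_measurable => i _.
    by apply: measurableC; exact: mXA.
  by apply: bigcup_measurable => j _; case: (HZ (i, j)).
have PBad : P Bad = 0%E.
  apply/negligibleP => //; apply: negligibleU; apply: negligible_bigcup => i.
    by apply/negligibleP; [apply: measurableC; exact: mXA|exact: PXW].
  by apply: negligible_bigcup => j; have [? ? _] := HZ (i, j); apply/negligibleP.
pose D := ~` Bad.
have mD : measurable D by exact: measurableC.
have PD : P (~` D) = 0%E by rewrite setCK.
have DW om i : D om -> W (X i om).
  by move=> Dom; apply: contrapT => nW; apply: Dom; left; exists i.
have Dinj om : D om -> injective (X ^~ om).
  move=> Dom i j Xij; apply/eqP; apply: contrapT => /negP ij; apply: (Dom); right.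
  exists i => //; exists j => //; have [_ _ /= H] := HZ (i, j).
  by apply: (H ij om) => //; exact: DW.
rewrite (@eq_integral_full _ _ _ P D _
  (fun om => (ustat4 (cross_kernel L delta) (X ^~ om) (N om))%:E))//; last first.
  by move=> om Dom; rewrite cr_bar_ustat4//; exact: Dinj.
rewrite [X in (_ * X)%E](@eq_integral_full _ _ _ P D _
  (fun om => (ustat2 (stress_kernel W L w) (X ^~ om) (N om))%:E))//; last first.
  move=> om Dom.
  by rewrite (stress_ustat2 _ (Dinj _ Dom) L w (fun i => DW _ i Dom)).
rewrite [leRHS](@eq_integral_full _ _ _ P D _
  (fun om => (ustat4 (cross_kernel L delta) (X ^~ om) (N om) *
    ustat2 (stress_kernel W L w) (X ^~ om) (N om))%:E))//; last first.
  move=> om Dom; rewrite (cr_bar_ustat4 _ (Dinj _ Dom)).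
  by rewrite (stress_ustat2 _ (Dinj _ Dom) L w (fun i => DW _ i Dom)).
(* The law of [X 0] stands for the uniform distribution: it is a probability measure by
   construction, so countable additivity of [vol_d], defined by coverings, need not be
   established. *)
pose X0 : {mfun O >-> @vec_borel R d} := mfun_Sub (mem_set (mX 0)).
apply: (@poisson_ustat_covariance R _ _ P _ (@vec_borel R d)
  (distribution P X0) N X t ht mN PN mX).
- move=> n l A ul mA.
  rewrite (poisson_pp_indep hV [set n] ul mA); congr (_ * _)%E.
  by apply: eq_bigr => i _; exact: etrans (PX i _ (mA i)) (esym (PX 0 _ (mA i))).
- exact: measurable_cross_kernel.
- exact: measurable_stress_kernel.
- by move=> v; exact: cross_kernel_ge0.
- by move=> v; exact: stress_kernel_ge0.
Qed.
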